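(* Let $n$ and $d$ be positive integers such that $d<n$ and let $T^\ast$ be the full caterpillar of degree $d$ on $n$ nodes. If $T$ is a rooted tree on $n$ nodes such that each internal node of $T$ has at most $d$ children, then $T\succ T^\ast$ or else $T=T^\ast$.
   Context: All rooted trees are finite, and equality $T=T^\ast$ means that $T$ and $T^\ast$ are isomorphic as rooted trees. A leaf of a rooted tree is a node with no children; an internal node is a node that is not a leaf. A transversal in a rooted tree is any set of nodes that meets every path from the root to a leaf (paths include both the root and the leaf). For a rooted tree $T$, $c(T,k)$ denotes the number of transversals of size $k$ in $T$. For rooted trees $T,T'$ on $n$ nodes, $T\succ T'$ means that $c(T,k)\ge c(T',k)$ for all $k=1,2,\ldots,n$ and that $c(T,k)>c(T',k)$ for at least one of these values of $k$. A caterpillar is a rooted tree where removal of all leaves produces a rooted tree with precisely one leaf (a single-node rooted tree has precisely one leaf, namely its root); equivalently, the internal nodes form a path descending from the root. A full caterpillar of degree $d$ is a caterpillar where each internal node, except possibly the lowest one, has precisely $d$ children, and the lowest internal node has at most $d$ children. For positive integers $d<n$, the full caterpillar of degree $d$ on $n$ nodes is unique up to isomorphism of rooted trees. *)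

(* Defs.v *)
From mathcomp Require Import all_boot.
From mathcomp Require Import boolp.

Set Implicit Arguments.
Unset Strict Implicit.
Unset Printing Implicit Defensive.

(* [child u v] reads "v is a child of u".  Acyclicity follows from the three
   axioms: the root has no parent, parents are unique, and every node is
   reachable from the root. *)
Record rtree := RTree {
  node :> finType;
  root : node;
  child : rel node;
  root_orphan : forall u, ~~ child u root;
  parent_uniq : forall u v w, child u w -> child v w -> u = v;
  root_connect : forall v, connect child root v
}.

Definition isomorphic (T T' : rtree) : Prop :=
  exists f : node T -> node T',
    [/\ bijective f, f (root T) = root T' &
        forall u v, child (f u) (f v) = child u v].

Section RootedTree.
Variable T : rtree.
Implicit Types (u v w : node T) (A S : {set node T}).

Definition children u : {set node T} := [set v | child u v].

(* Leaves of what remains of T when only the nodes of A are kept. *)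
Definition leaves_in A : {set node T} :=
  [set v in A | children v :&: A == set0].

Definition leaves : {set node T} := leaves_in setT.

Definition internal : {set node T} := ~: leaves.

(* The sequence root T :: p runs over all paths from the root to a leaf. *)
Definition transversal S : Prop :=
  forall p : seq (node T),
    path (@child T) (root T) p -> last (root T) p \in leaves ->
    exists2 v, v \in root T :: p & v \in S.

Definition ntransversals (k : nat) : nat :=
  #|[set S : {set node T} | `[< transversal S >] & #|S| == k]|.

Definition caterpillar : Prop := #|leaves_in internal| = 1.

(* In a caterpillar, leaves_in internal is the singleton consisting of the
   lowest internal node. *)
Definition full_caterpillar (d : nat) : Prop :=
  [/\ caterpillar,
      forall v, v \in internal -> v \notin leaves_in internal ->
        #|children v| = d &
      forall v, v \in leaves_in internal -> #|children v| <= d].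

End RootedTree.

Definition dominates (T T' : rtree) : Prop :=
  [/\ #|node T| = #|node T'|,
      forall k, 1 <= k <= #|node T| -> ntransversals T' k <= ntransversals T k &
      exists2 k, 1 <= k <= #|node T| & ntransversals T' k < ntransversals T k].

(* Main.v *)
From mathcomp Require Import all_boot all_algebra.
From mathcomp Require Import boolp ring zify.
Require Import Defs.

Set Implicit Arguments.
Unset Strict Implicit.
Unset Printing Implicit Defensive.
Import GRing.Theory.

(** Count transversals by size with a polynomial: for a node [v], let
    [transpoly v] be the sum of ['X^#|S|] over the sets [S] of descendants of
    [v] that meet every path from [v] to a leaf.  If the subtree at [v] has
    [k + 1] nodes, then either [v] is in [S], and the other [k] nodes are free,
    or [S] splits into independent transversals of the subtrees at the children
    of [v] (impossible if [v] is a leaf), so ([transpolyE])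
      [transpoly v = 'X (1 + 'X)^k + \prod_(w child of v) transpoly w].
    For the full caterpillar with [k + 1] nodes, [k > 0], whose root has
    [minn k d] children of which at most one is internal, this reads
      [catpoly k = 'X (1 + 'X)^k + 'X^(minn k d - 1) catpoly (k - d)],
    with [catpoly 0 = 'X].

    The theorem then reduces to two coefficientwise inequalities:
      ['X^i catpoly k <= catpoly (i + k)]          ([coef_leif_catpolyXn]),
      ['X catpoly (a + b) <= catpoly a * catpoly b] ([coef_leif_catpolyM]).
    The second says that merging two subtrees of a node into a leaf and one
    larger caterpillar does not increase the counts, the first that giving the
    node more leaf children at the expense of that caterpillar does not either.
    By induction on subtrees, [catpoly] is a lower bound for [transpoly].

    Equality is tracked along the way: [coef_leif p q C] says that [p] is
    coefficientwise at most [q], with equality exactly when the boolean [C]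
    holds.  In the first inequality [C] is [i == 0], in the second it is
    [(a == 0) || (b == 0)], and combining them shows ([transpoly_leif]) that
    the bound is attained exactly when every node [u] satisfies
    [comb_node d u]: at most one internal child, and exactly [d] children if
    there is one.  Full caterpillars have this property
    ([full_caterpillar_comb]), and two trees of the same size with this property
    and at most [d] children per node are isomorphic ([comb_isomorphic]),
    because the nodes of such a tree can be numbered so that the parent of node
    [j + 1] is node [j %/ d * d] ([comb_enum]). *)

(** * Coefficientwise comparison of polynomials *)

Section PolyOrder.
Local Open Scope ring_scope.
Implicit Types p q r : {poly nat}.

Definition coef_total p : nat := p.[1].

(** The equality condition is read off the sums of coefficients: given the
    coefficientwise inequality, these agree only if the polynomials do
    ([coef_leif_eq]), and [coef_total] is a semiring morphism, so that equality
    conditions combine as they do for numbers. *)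
Definition coef_leif p q (C : bool) : Prop :=
  (forall k, (p`_k)%R <= (q`_k)%R)%N /\
  (coef_total p <= coef_total q ?= iff C)%N.

Lemma coef_totalD p q : coef_total (p + q) = (coef_total p + coef_total q)%N.
Proof. exact: hornerD. Qed.

Lemma coef_totalM p q : coef_total (p * q) = (coef_total p * coef_total q)%N.
Proof. exact: hornerM. Qed.

Lemma coef_totalX : coef_total 'X = 1%N.
Proof. exact: hornerX. Qed.

Lemma coef_totalXn i : coef_total 'X^i = 1%N.
Proof. by rewrite /coef_total hornerXn expr1n. Qed.

Lemma coef_total1DXn i : coef_total ((1 + 'X) ^+ i) = (2 ^ i)%N.
Proof. by rewrite /coef_total horner_exp !hornerE natrXE. Qed.

Lemma coef_totalE p n : (size p <= n)%N ->
  coef_total p = (\sum_(i < n) (p`_i)%R)%N.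
Proof.
move=> sz; rewrite /coef_total (horner_coef_wide _ sz).
by apply: eq_bigr => i _; rewrite expr1n mulr1.
Qed.

Lemma coef_leif_refl p : coef_leif p p true.
Proof. by split=> [k|]; rewrite ?leqnn //; apply/leqif_refl. Qed.

Lemma coef_leif_eq p q : coef_leif p q true -> p = q.
Proof.
move=> [le_pq [_]] /eqP; pose n := maxn (size p) (size q).
rewrite (@coef_totalE p n) ?leq_maxl // (@coef_totalE q n) ?leq_maxr // =>
  eq_pq.
apply/polyP => k; case: (ltnP k n) => [lt_kn|]; last first.
  by rewrite geq_max => /andP[lep leq]; rewrite !nth_default.
have [_] := @leqif_sum 'I_n xpredT (fun i => p`_i == q`_i) (fun i => p`_i)
  (fun i => q`_i) (fun i _ => conj (le_pq i) erefl).
rewrite {1}eq_pq eqxx => /esym/forallP/(_ (Ordinal lt_kn)) /=.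
by move/eqP.
Qed.

Lemma coef_leif_trans q p r C D :
  coef_leif p q C -> coef_leif q r D -> coef_leif p r (C && D).
Proof.
move=> [le_pq lif_pq] [le_qr lif_qr]; split=> [k|].
  exact: leq_trans (le_qr k).
exact: leqif_trans lif_qr.
Qed.

Lemma coef_leifD p q p' q' C D :
  coef_leif p q C -> coef_leif p' q' D -> coef_leif (p + p') (q + q') (C && D).
Proof.
move=> [le_pq lif_pq] [le_pq' lif_pq']; split=> [k|].
  by rewrite !coefD; apply: leq_add.
by rewrite !coef_totalD; apply: leqif_add.
Qed.

(** Positivity is what makes equality of the products force equality of both
    factors. *)
Lemma coef_leifM p q p' q' C D :
  (0 < coef_total p)%N -> (0 < coef_total p')%N ->
  coef_leif p q C -> coef_leif p' q' D -> coef_leif (p * p') (q * q') (C && D).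
Proof.
move=> p_gt0 p'_gt0 [le_pq lif_pq] [le_pq' lif_pq']; split=> [k|].
  by rewrite !coefM; apply: leq_sum => i _; apply: leq_mul.
rewrite !coef_totalM; have := leqif_mul lif_pq lif_pq'.
have q_gt0 := leq_trans p_gt0 lif_pq.1.
have q'_gt0 := leq_trans p'_gt0 lif_pq'.1.
by rewrite muln_eq0 !gtn_eqF.
Qed.

Lemma coef_leifMl r p q C : (0 < coef_total r)%N -> (0 < coef_total p)%N ->
  coef_leif p q C -> coef_leif (r * p) (r * q) C.
Proof.
by move=> r0 p0 le_pq; apply: (coef_leifM r0 p0 (coef_leif_refl r) le_pq).
Qed.

Lemma coef_leifXI p q C : coef_leif ('X * p) ('X * q) C -> coef_leif p q C.
Proof.
move=> [le_pq]; rewrite !coef_totalM !coef_totalX !mul1n => lif_pq;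
  split=> // k.
by have := le_pq k.+1; rewrite !coefXM.
Qed.

Lemma coef_leif_false_lt (p q : {poly nat}) :
  coef_leif p q false -> exists k, ((p`_k)%R < (q`_k)%R)%N.
Proof.
move=> [le_pq lif_pq]; apply: contrapT => nlt.
have eq_pq : p = q.
  apply/polyP => k; apply/eqP; rewrite eqn_leq le_pq leqNgt /=.
  by apply/negP => lt_k; apply: nlt; exists k.
by have := lif_pq.2; rewrite eq_pq eqxx.
Qed.

End PolyOrder.

(** * The transversal polynomial of a full caterpillar *)

Section CaterpillarPoly.
Local Open Scope ring_scope.
Variable d : nat.

(** The argument is the number of nodes other than the root.  The recursive call
    is at [k - d], written so that it is visibly structural: see [catpolyS].
    Subtraction truncates, which for [0 < k <= d] yields the star. *)
Fixpoint catpoly k : {poly nat} :=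
  if k is k'.+1
  then 'X * (1 + 'X) ^+ k + 'X ^+ (minn k d).-1 * catpoly (k' - d.-1)%N
  else 'X.

Hypothesis d_gt0 : (0 < d)%N.

Lemma catpolyS k : catpoly k.+1 =
  'X * (1 + 'X) ^+ k.+1 + 'X ^+ (minn k.+1 d).-1 * catpoly (k.+1 - d)%N.
Proof. by have -> : (k.+1 - d = k - d.-1)%N by lia. Qed.

Lemma catpoly_gt0 k : (0 < coef_total (catpoly k))%N.
Proof.
case: k => [|k]; first by rewrite coef_totalX.
by rewrite /= coef_totalD coef_totalM coef_totalX coef_total1DXn mul1n addn_gt0
  expn_gt0.
Qed.

Local Ltac pos := rewrite ?coef_totalM ?coef_totalX ?coef_totalXn
  ?coef_total1DXn ?muln_gt0 ?expn_gt0 ?catpoly_gt0 //.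

(** For [k > 0], the first terms of the two recursions already give a strict
    inequality; the second terms are compared by induction if [d <= k], and
    agree otherwise. *)
Lemma coef_leif_catpolyX1 k : coef_leif ('X * catpoly k) (catpoly k.+1) false.
Proof.
have le1 j :
    coef_leif ('X * ('X * (1 + 'X) ^+ j)) ('X * (1 + 'X) ^+ j.+1) false.
  have -> : 'X * (1 + 'X) ^+ j.+1 =
    'X * ('X * (1 + 'X) ^+ j) + 'X * (1 + 'X) ^+ j :> {poly nat}.
    by rewrite exprS; ring.
  split=> [i|]; first by rewrite coefD leq_addr.
  apply/leqifP => /=; rewrite coef_totalD -[X in (X < _)%N]addn0 ltn_add2l; pos.
have [n] := ubnP k; elim: n k => // n IHn [|k] lt_kn.
  have -> : catpoly 1 = 'X + ('X * 'X + 'X).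
    rewrite catpolyS.
    have -> : minn 1 d = 1%N by lia.
    have -> : (1 - d = 0)%N by lia.
    by rewrite expr1 mulrDr mulr1 mul1r addrA.
  split=> [i|]; first by rewrite addrCA coefD leq_addr.
  by apply/leqifP; rewrite !coef_totalD !coef_totalM !coef_totalX.
rewrite [catpoly k.+2]catpolyS [catpoly k.+1]catpolyS mulrDr.
have /orP[le_dk|lt_kd] := leqVgt d k.+1.
  have -> : minn k.+2 d = d by lia.
  have -> : minn k.+1 d = d by lia.
  have -> : (k.+2 - d = (k.+1 - d).+1)%N by lia.
  rewrite [X in _ + X]mulrCA; apply: (coef_leifD (le1 k.+1)).
  by apply: coef_leifMl; [pos|pos|apply: IHn; lia].
have -> : minn k.+2 d = k.+2 by lia.
have -> : minn k.+1 d = k.+1 by lia.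
have -> : (k.+2 - d = 0)%N by lia.
have -> : (k.+1 - d = 0)%N by lia.
rewrite [X in _ + X]mulrA -exprS.
exact: (coef_leifD (le1 k.+1) (coef_leif_refl _)).
Qed.

Lemma coef_leif_catpolyXn i k :
  coef_leif ('X^i * catpoly k) (catpoly (i + k)) (i == 0%N).
Proof.
elim: i => [|i IHi]; first by rewrite mul1r; apply: coef_leif_refl.
rewrite exprS -mulrA addSn -[i.+1 == 0%N](andbF (i == 0%N)).
by apply: coef_leif_trans (coef_leif_catpolyX1 _); apply: coef_leifMl; pos.
Qed.

Lemma coef_leif_catpoly_rooted k :
  coef_leif ('X * (1 + 'X) ^+ k) (catpoly k) (k == 0%N).
Proof.
case: k => [|k]; first by rewrite expr0 mulr1; apply: coef_leif_refl.
rewrite catpolyS; split=> [i|]; first by rewrite coefD leq_addr.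
apply/leqifP => /=; rewrite coef_totalD -[X in (X < _)%N]addn0 ltn_add2l; pos.
Qed.

(** For [a, b > 0], unfold [catpoly a] and [catpoly (a + b)] once.  The terms
    for transversals containing the root compare through
    [coef_leif_catpoly_rooted]; the others compare by induction on [a], except
    that the two recursions may have split off different numbers of children,
    [minn a d] and [minn (a + b) d], a gap closed by [coef_leif_catpolyXn]. *)
Lemma coef_leif_catpolyM a b :
  coef_leif ('X * catpoly (a + b)) (catpoly a * catpoly b)
    ((a == 0%N) || (b == 0%N)).
Proof.
have [n] := ubnP a; elim: n a => // n IHn [|a] lt_an.
  exact: coef_leif_refl.
have [->|b_neq0] := eqVneq b 0%N.
  by rewrite addn0 [catpoly a.+1 * _]mulrC; apply: coef_leif_refl.
rewrite addSn [catpoly (a + b).+1]catpolyS -addSn [catpoly a.+1]catpolyS.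
rewrite mulrDl mulrDr.
have le_rooted : coef_leif ('X * ('X * (1 + 'X) ^+ (a.+1 + b)))
    ('X * (1 + 'X) ^+ a.+1 * catpoly b) false.
  have -> : 'X * ('X * (1 + 'X) ^+ (a.+1 + b)) =
    'X * (1 + 'X) ^+ a.+1 * ('X * (1 + 'X) ^+ b) :> {poly nat}.
    by rewrite exprD; ring.
  rewrite -(negPf b_neq0).
  by apply: coef_leifMl (coef_leif_catpoly_rooted b); pos.
apply: (coef_leifD le_rooted).
pose i := (minn (a.+1 + b) d - minn a.+1 d)%N.
have -> : (minn (a.+1 + b) d).-1 = ((minn a.+1 d).-1 + i)%N by lia.
rewrite exprD mulrCA -!mulrA; apply: coef_leifMl; [pos|pos|].
rewrite mulrCA.
apply: (coef_leif_trans (q := 'X * catpoly ((a.+1 - d) + b))); last first.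
  by apply: IHn; lia.
have -> : (a.+1 - d + b = i + (a.+1 + b - d))%N by lia.
by apply: coef_leifMl (coef_leif_catpolyXn _ _); pos.
Qed.

(** Iterating [coef_leif_catpolyM].  The extra factor ['X] on the right makes
    the formula hold for empty [r] too. *)
Lemma coef_leif_catpoly_prod (I : Type) (r : seq I) (wt : I -> nat) :
  coef_leif ('X^(size r) * catpoly (\sum_(i <- r) wt i)%N)
    ('X * \prod_(i <- r) catpoly (wt i)) (count (fun i => 0 < wt i) r <= 1)%N.
Proof.
elim: r => [|i r IHr].
  by rewrite !big_nil mul1r mulr1; apply: coef_leif_refl.
rewrite !big_cons /= exprS -mulrA.
rewrite [X in coef_leif X _]mulrCA [X in coef_leif _ X]mulrCA.
set w := (\sum_(j <- r) wt j)%N.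
have w_eq0 : (w == 0%N) = (count (fun i => 0 < wt i)%N r == 0%N).
  rewrite /w sum_nat_seq_eq0 -leqn0 leqNgt -has_count -all_predC.
  by apply: eq_all => j /=; rewrite lt0n negbK.
set c := count _ r in IHr w_eq0 *.
have -> : ((0 < wt i) + c <= 1)%N = ((wt i == 0%N) || (w == 0%N)) && (c <= 1)%N.
  by rewrite w_eq0; case: (wt i) => [|?] /=; case: (c) => [|[|?]].
have prod_gt0 : (0 < coef_total ('X^(size r) * catpoly w))%N by pos.
apply: coef_leif_trans (coef_leifMl (catpoly_gt0 _) prod_gt0 IHr).
rewrite [X in coef_leif _ X]mulrCA.
by apply: coef_leifMl (coef_leif_catpolyM _ _); pos.
Qed.

Lemma coef_leif_prod (I : eqType) (r : seq I) (F G : I -> {poly nat})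
    (C : pred I) :
  {in r, forall i, 0 < coef_total (F i)}%N ->
  {in r, forall i, coef_leif (F i) (G i) (C i)} ->
  coef_leif (\prod_(i <- r) F i) (\prod_(i <- r) G i) (all C r).
Proof.
elim: r => [|i r IHr] F_gt0 leFG.
  by rewrite !big_nil; apply: coef_leif_refl.
have in_r j : j \in r -> j \in i :: r by rewrite inE orbC => ->.
rewrite !big_cons /=; apply: coef_leifM.
- by apply: F_gt0; rewrite mem_head.
- rewrite big_seq.
  apply: (big_ind (fun p => 0 < coef_total p)%N) => [|p q p0 q0|].
  + by rewrite (coef_totalXn 0).
  + by rewrite coef_totalM muln_gt0 p0.
  + by move=> j /in_r/F_gt0.
- by apply: leFG; rewrite mem_head.
- by apply: IHr => j /in_r; [apply: F_gt0|apply: leFG].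
Qed.

(** The induction step of the lower bound: [r] lists the children of a node,
    [wt i] is the size of the subtree at child [i] without its root, and
    [k] the number of proper descendants of the node.  Three comparisons lead
    from the caterpillar to the node: the number of children is lowered from
    [minn k d] to [size r], the only large subtree is split among the children,
    and the caterpillars at the children are replaced by the actual subtrees. *)
Lemma coef_leif_catpoly_node (I : eqType) (r : seq I) (wt : I -> nat)
    (F : I -> {poly nat}) (C : pred I) (k := (\sum_(i <- r) (wt i).+1)%N) :
  (0 < size r <= d)%N ->
  {in r, forall i, coef_leif (catpoly (wt i)) (F i) (C i)} ->
  coef_leif (catpoly k) ('X * (1 + 'X) ^+ k + \prod_(i <- r) F i)
    [&& size r == minn k d, count (fun i => 0 < wt i) r <= 1 & all C r]%N.
Proof.
move=> /andP[r_gt0 le_rd] leF.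
have k_sum : k = (size r + \sum_(i <- r) wt i)%N.
  by rewrite /k -sum1_size -big_split.
have [k' def_k] : exists k', k = k'.+1 by exists k.-1; lia.
rewrite def_k catpolyS -def_k.
apply: (coef_leifD (coef_leif_refl _)); apply: coef_leifXI.
rewrite mulrA -exprS prednK; last by lia.
(* [i] is the number of children by which the caterpillar is ahead. *)
pose i := (minn k d - size r)%N.
have -> : minn k d = (size r + i)%N by lia.
have -> : (size r == size r + i)%N = (i == 0%N) by lia.
have le_root : coef_leif ('X^(size r + i) * catpoly (k - d))
    ('X^(size r) * catpoly (\sum_(j <- r) wt j)%N) (i == 0%N).
  have -> : (\sum_(j <- r) wt j = i + (k - d))%N by lia.
  rewrite exprD -mulrA.
  by apply: coef_leifMl (coef_leif_catpolyXn _ _); pos.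
apply: (coef_leif_trans le_root).
apply: (coef_leif_trans (coef_leif_catpoly_prod r wt)).
apply: coef_leifMl; [pos| |].
  apply: (big_ind (fun p => 0 < coef_total p)%N) => [|p q p0 q0|j _].
  - by rewrite (coef_totalXn 0).
  - by rewrite coef_totalM muln_gt0 p0.
  - exact: catpoly_gt0.
by apply: coef_leif_prod => // j _; apply: catpoly_gt0.
Qed.

End CaterpillarPoly.

(** * Descendants *)

Section Descendants.
Variable T : rtree.
Implicit Types (u v w x : node T) (S : {set node T}).

Local Notation "u <~ v" := (connect (@child T) u v) (at level 70).

Definition desc v : {set node T} := [set w | v <~ w].

Lemma connect_childl v w : v <~ w -> v = w \/ exists2 u, child v u & u <~ w.
Proof.
move=> /connectP[[|u p] /= vp ->]; first by left.
move/andP: vp => [vu up]; right; exists u => //.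
by apply/connectP; exists p.
Qed.

Lemma connect_childr v w : v <~ w -> v = w \/ exists2 u, v <~ u & child u w.
Proof.
move=> /connectP[p]; case/lastP: p => [|p u] /=; first by left.
rewrite rcons_path last_rcons => /andP[vp pu] ->; right.
by exists (last v p) => //; apply/connectP; exists p.
Qed.

Lemma connect_ind_up (P : node T -> Prop) v w :
  (forall x y, child x y -> P y -> P x) -> v <~ w -> P w -> P v.
Proof.
move=> Pup /connectP[p vp ->{w}]; elim: p v vp => //= u p IHp v /andP[vu up].
by move=> Plast; apply: Pup vu (IHp _ up Plast).
Qed.

(** The parent of a node on a cycle is on the same cycle, since parents are
    unique.  Climbing from a cycle, one would thus find the root on a cycle,
    although it has no parent. *)
Lemma child_acyclic v w : child v w -> ~~ (w <~ v).
Proof.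
move=> vw; apply/negP => wv.
(* [P x]: the node [x] lies on a cycle. *)
pose P x := exists2 y, child x y & y <~ x.
have [|||y ry yr] := @connect_ind_up P (root T) v; last 1 first.
- case/connect_childr: yr => [eq_yr|[x _ xr]].
    by rewrite eq_yr (negPf (root_orphan _)) in ry.
  by rewrite (negPf (root_orphan _)) in xr.
- move=> x y xy [z yz /connect_childr[eq_zy|[y' zy' y'y]]].
    by rewrite eq_zy in yz; exists y => //;
      rewrite (parent_uniq xy yz) connect0.
  exists y => //; rewrite (parent_uniq xy y'y).
  exact: connect_trans (connect1 yz) zy'.
- exact: root_connect.
- by exists w.
Qed.

(** Climb from [w]: as parents are unique, both ancestors are met on the same
    way up. *)
Lemma connect_chain u v w : u <~ w -> v <~ w -> (u <~ v) || (v <~ u).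
Proof.
move=> uw /connectP[p]; elim/last_ind: p w uw => [|p x IHp] w uw /=.
  by move=> _ def_w; rewrite -def_w uw.
rewrite rcons_path last_rcons => /andP[vp px] def_w.
case/connect_childr: uw => [->|[y uy yw]].
  by rewrite def_w orbC (connect_trans _ (connect1 px)) //; apply/connectP;
    exists p.
by apply: (IHp y) => //; apply: parent_uniq yw _; rewrite def_w.
Qed.

Lemma childE v w : (w \in children v) = child v w. Proof. by rewrite inE. Qed.

(** Both siblings are ancestors of [x], so one is a descendant of the other
    ([connect_chain]), and then [v] would be its own proper descendant. *)
Lemma siblings_disjoint v u w x :
  child v u -> child v w -> x \in desc u -> x \in desc w -> u = w.
Proof.
rewrite !inE => vu vw ux wx.
wlog uw: u w vu vw ux wx / u <~ w.
  move=> H; case/orP: (connect_chain ux wx) => [|wu]; first exact: H.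
  by apply: esym; apply: H.
case/connect_childr: uw => // -[y uy yw].
by have := child_acyclic vu; rewrite (parent_uniq vw yw) uy.
Qed.

Lemma desc_children v : desc v = v |: \bigcup_(w in children v) desc w.
Proof.
apply/setP => x; rewrite !inE.
apply/idP/orP => [/connect_childl[->|[u vu ux]]|].
- by left.
- by right; apply/bigcupP; exists u; rewrite inE.
case=> [/eqP-> //|/bigcupP[u]]; rewrite !inE => vu ux.
exact: connect_trans (connect1 vu) ux.
Qed.

Lemma notin_desc_children v : v \notin \bigcup_(w in children v) desc w.
Proof.
apply/bigcupP => -[w]; rewrite !inE => vw wv.
by have := child_acyclic vw; rewrite wv.
Qed.

Lemma desc_refl v : v \in desc v. Proof. by rewrite inE. Qed.

Lemma desc_root : desc (root T) = [set: node T].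
Proof. by apply/setP => x; rewrite !inE root_connect. Qed.

Lemma card_desc_gt0 v : 0 < #|desc v|.
Proof. by apply/card_gt0P; exists v; apply: desc_refl. Qed.

Lemma card_bigcup_children v (F : node T -> {set node T}) :
  {in children v, forall w, F w \subset desc w} ->
  #|\bigcup_(w in children v) F w| = \sum_(w in children v) #|F w|.
Proof.
move=> sub_desc; pose G w := if w \in children v then F w else set0.
have -> : \bigcup_(w in children v) F w = \bigcup_w G w.
  by rewrite big_mkcond; apply: eq_bigr => w _; rewrite /G; case: ifP.
rewrite -sum1_card partition_disjoint_bigcup => [|u w neq_uw].
  rewrite [RHS]big_mkcond; apply: eq_bigr => w _ /=.
  by rewrite sum1_card /G; case: ifP => // _; rewrite cards0.
rewrite -setI_eq0 /G; apply: contra_neqT neq_uw => /set0Pn[x].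
case: ifP => vu; case: ifP => vw; rewrite inE ?inE ?andbF //.
move=> /andP[ux wx]; rewrite !childE in vu vw.
apply: (siblings_disjoint vu vw (x := x)).
  by apply: (subsetP (sub_desc u _)); rewrite ?childE.
by apply: (subsetP (sub_desc w _)); rewrite ?childE.
Qed.

Lemma card_desc v : #|desc v| = (\sum_(w in children v) #|desc w|).+1.
Proof.
rewrite desc_children cardsU1 notin_desc_children add1n.
by rewrite card_bigcup_children.
Qed.

Lemma card_desc_child v w : child v w -> #|desc w| < #|desc v|.
Proof.
by move=> vw; rewrite (card_desc v) ltnS (bigD1 w) ?inE // leq_addr.
Qed.

(** * The transversal polynomial of a subtree *)

Lemma leavesE v : (v \in leaves T) = (children v == set0).
Proof. by rewrite !inE setIT. Qed.

Lemma internalE v : (v \in internal T) = (children v != set0).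
Proof. by rewrite inE leavesE. Qed.

(** At the root this is [transversal] by definition. *)
Definition hits v S : Prop := forall p : seq T,
  path (@child T) v p -> last v p \in leaves T ->
  exists2 x, x \in v :: p & x \in S.

Lemma hits_rec v S : hits v S <->
  v \in S \/ children v != set0 /\ forall w, w \in children v -> hits w S.
Proof.
split=> [vS|[vS|[nlv chS]] p].
- have [|vnS] := boolP (v \in S); [by left|right].
  split=> [|w].
    apply/negP; rewrite -leavesE => lv; have [//|x] := vS [::] isT.
    by rewrite inE => /eqP->; apply/negP.
  rewrite inE => vw p wp lp; have [||x] := vS (w :: p).
  + by rewrite /= vw.
  + by [].
  + rewrite inE => /orP[/eqP->|xp xS]; first by rewrite (negPf vnS).
    by exists x.
- by move=> _ _; exists v => //; rewrite mem_head.
- case: p => [|w p] /=; first by rewrite leavesE (negPf nlv).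
  move=> /andP[vw wp] lp; have [|x xp xS] := chS w _ p wp lp;
    first by rewrite inE.
  by exists x => //; rewrite inE xp orbT.
Qed.

Lemma hitsI v S : hits v (S :&: desc v) <-> hits v S.
Proof.
split=> vS p vp lp; have [x xp xS] := vS p vp lp; exists x => //.
  by case/setIP: xS.
rewrite !inE xS; move: xp; rewrite inE => /orP[/eqP->|];
  first by rewrite connect0.
elim: p v vp {vS lp} => //= u p IHp v /andP[vu up]; rewrite inE.
move=> /orP[/eqP->|/(IHp _ up)]; first exact: connect1.
exact/connect_trans/connect1.
Qed.

Local Open Scope ring_scope.

Definition transpoly v : {poly nat} :=
  \sum_(S : {set node T} | (S \subset desc v) && `[< hits v S >]) 'X^#|S|.

Lemma ntransversalsE k : ntransversals T k = (transpoly (root T))`_k.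
Proof.
rewrite /transpoly coef_sum /ntransversals -sum1_card big_mkcond
  [RHS]big_mkcond.
apply: eq_bigr => S _; rewrite inE desc_root subsetT coefXn eq_sym.
have -> : `[< transversal S >] = `[< hits (root T) S >] by [].
by case: asbool => //=; case: eqP.
Qed.

(** Expand [(1 + 'X) ^+ #|B|] as a product over all nodes, with a
    trivial factor outside [B]. *)
Lemma sum_subset_Xn (B : {set node T}) :
  \sum_(S : {set node T} | S \subset B) 'X^#|S|
  = (1 + 'X) ^+ #|B| :> {poly nat}.
Proof.
pose F i : {poly nat} := if i \in B then 'X else 0.
have -> : (1 + 'X) ^+ #|B| = \prod_i (F i + 1).
  rewrite -prodr_const big_mkcond; apply: eq_bigr => i _; rewrite /F.
  by case: ifP => _; rewrite ?add0r // addrC.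
rewrite bigA_distr /= big_mkcond; apply: eq_bigr => S _.
rewrite -big_mkcond /=; case: ifPn => [/subsetP sSB|/subsetPn[x xS xB]].
  by rewrite -prodr_const; apply: eq_bigr => i /sSB; rewrite /F => ->.
by rewrite (bigD1 x) //= /F (negPf xB) mul0r.
Qed.

Lemma sum_hits_with_root v :
  \sum_(S : {set node T} | (S \subset desc v) && `[< hits v S >] && (v \in S))
    'X^#|S| = 'X * (1 + 'X) ^+ #|desc v|.-1 :> {poly nat}.
Proof.
have vD : #|desc v|.-1 = #|desc v :\ v|.
  by rewrite [#|desc v|](cardsD1 v) desc_refl.
rewrite vD -sum_subset_Xn big_distrr /=.
rewrite (reindex_onto (fun S => v |: S) (fun S => S :\ v)); last first.
  by move=> S /andP[_ vS]; apply: setD1K.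
apply: eq_big => [S|S].
  have -> : `[< hits v (v |: S) >].
    by apply/asboolP/hits_rec; left; rewrite setU11.
  rewrite setU11 !andbT subUset sub1set desc_refl /= subsetD1.
  congr (_ && _); apply/eqP/idP => [<-|vS]; last exact: setU1K.
  by rewrite !inE eqxx.
case/andP=> _ /eqP defS; have vS : v \notin S by rewrite -defS !inE eqxx.
by rewrite cardsU1 vS add1n exprS.
Qed.

(** The sets [S] correspond to the families of their traces on the subtrees at
    the children of [v]; [h] and [h'] below are the two directions of this
    bijection. *)
Lemma sum_hits_without_root v : children v != set0 ->
  \sum_(S : {set node T} |
      (S \subset desc v) && `[< hits v S >] && (v \notin S))
    'X^#|S| = \prod_(w in children v) transpoly w :> {poly nat}.
Proof.
move=> nlv; rewrite (big_distr_big_dep set0) /=.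
pose h (f : {ffun node T -> {set node T}}) := \bigcup_(w in children v) f w.
pose h' (S : {set node T}) :=
  [ffun w => if w \in children v then S :&: desc w else set0].
rewrite (reindex_onto h' h) => [|f /pfamilyP[/subsetP supp_f f_fam]];
  last first.
  apply/ffunP => w; rewrite ffunE; case: ifPn => [vw|nvw]; last first.
    by apply/esym/eqP; apply: contraNT nvw => /supp_f.
  apply/setP => x; rewrite inE; apply/andP/idP => [[/bigcupP[u vu xu] wx]|xw].
    have /andP[/subsetP sub_u _] := f_fam u vu.
    rewrite !childE in vu vw.
    by rewrite -(siblings_disjoint vu vw (sub_u _ xu) wx).
  have /andP[/subsetP sub_w _] := f_fam w vw.
  by split; [apply/bigcupP; exists w | apply: sub_w].
have h'E S w : w \in children v -> h' S w = S :&: desc w.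
  by move=> vw; rewrite ffunE vw.
have hE S : h (h' S) = S :&: \bigcup_(w in children v) desc w.
  by rewrite setIC big_distrl /=; apply: eq_bigr => w vw; rewrite h'E // setIC.
have hK S : (h (h' S) == S) = (S \subset desc v) && (v \notin S).
  rewrite hE; apply/eqP/andP => [/setIidPl sSU|[sSD vS]]; last apply/setIidPl.
    split; first by rewrite desc_children (subset_trans sSU) ?subsetUr.
    exact: contra (subsetP sSU v) (notin_desc_children v).
  apply/subsetP => x xS; have := subsetP sSD x xS; rewrite desc_children inE.
  by rewrite inE => /orP[/eqP eq_xv|//]; rewrite -eq_xv xS in vS.
apply: eq_big => [S|S].
  rewrite hK; case: (S \subset _) => /=; last by rewrite andbF.
  have [vS|vS] := boolP (v \in S); rewrite ?andbF // !andbT.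
  apply/asboolP/pfamilyP => [/hits_rec[|[_ chS]]|[_ famS]].
  - by rewrite (negPf vS).
  - split=> [|w vw].
      by apply/subsetP=> w; apply: contraR; rewrite ffunE => /negPf->.
    by rewrite h'E // unfold_in subsetIr; apply/asboolP/hitsI/chS.
  - apply/hits_rec; right; split=> // w vw.
    by have := famS w vw; rewrite h'E // => /andP[_ /asboolP/hitsI].
move=> /andP[/andP[sSD _] vS].
rewrite -expr_sum -card_bigcup_children => [|w vw];
  last by rewrite h'E ?subsetIr.
by have /eqP := hK S; rewrite /h sSD vS => /eqP/eqP ->.
Qed.

Lemma transpolyE v : transpoly v = 'X * (1 + 'X) ^+ #|desc v|.-1 +
  (if children v == set0 then 0 else \prod_(w in children v) transpoly w).
Proof.
rewrite /transpoly (bigID (fun S => v \in S)) sum_hits_with_root; congr (_ + _).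
case: ifPn => [ch0|nlv]; last exact: sum_hits_without_root.
apply: big_pred0 => S; apply/negP => /andP[/andP[_ /asboolP/hits_rec[->//|[]]]].
by rewrite ch0.
Qed.

Lemma card_desc_gt1 v : (0 < #|desc v|.-1)%N = (v \in internal T).
Proof.
rewrite internalE card_desc /=; apply/idP/set0Pn => [|[w vw]].
  have [ch0|/set0Pn//] := eqVneq (children v) set0.
  by rewrite ch0 big_set0.
by rewrite (bigD1 w) //= ltn_addr ?card_desc_gt0.
Qed.

Lemma forall_desc (P : pred (node T)) v :
  [forall u in desc v, P u] =
  P v && all (fun w => [forall u in desc w, P u]) (enum (children v)).
Proof.
apply/forall_inP/andP => [Pdesc|[Pv /allP Pch] u].
  split; first by apply: Pdesc; apply: desc_refl.
  apply/allP => w; rewrite mem_enum => vw; apply/forall_inP => u wu.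
  by apply: Pdesc; rewrite desc_children inE; apply/orP; right;
    apply/bigcupP; exists w.
rewrite desc_children !inE => /orP[/eqP-> //|/bigcupP[w vw wu]].
have /forall_inP : [forall u in desc w, P u] by apply: Pch; rewrite mem_enum.
exact.
Qed.

(** The local form of the definition of a full caterpillar: a tree with more
    than one node and at most [d] children per node is a full caterpillar of
    degree [d] exactly when all its nodes satisfy this. *)
Definition comb_node d v :=
  [&& #|children v :&: internal T| <= 1 &
      (#|children v :&: internal T| == 1) ==> (#|children v| == d)]%N.

(** Induction on the size of the subtree through [transpolyE] and
    [coef_leif_catpoly_node]; the rest of the proof identifies the equality
    condition of the latter with [comb_node]. *)
Lemma transpoly_leif d v : (0 < d)%N -> (forall u, #|children u| <= d)%N ->
  coef_leif (catpoly d #|desc v|.-1) (transpoly v)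
    [forall u in desc v, comb_node d u].
Proof.
move=> d_gt0 deg_le.
have [n] := ubnP #|desc v|; elim: n v => // n IHn v lt_vn.
rewrite transpolyE; have [ch0|nlv] := eqVneq (children v) set0.
  have Dv : desc v = [set v] by rewrite desc_children ch0 big_set0 setU0.
  rewrite Dv cards1 addr0 expr0 mulr1.
  have -> : [forall u in [set v], comb_node d u].
    by apply/forall_inP => u /set1P ->; rewrite /comb_node ch0 set0I cards0.
  exact: coef_leif_refl.
pose wt w := #|desc w|.-1; pose C w := [forall u in desc w, comb_node d u].
have size_r : size (enum (children v)) = #|children v| by rewrite -cardE.
have sum_r : #|desc v|.-1 = (\sum_(w <- enum (children v)) (wt w).+1)%N.
  rewrite card_desc big_enum /=; apply: eq_bigr => w _.
  by rewrite /wt prednK ?card_desc_gt0.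
have := @coef_leif_catpoly_node d d_gt0 _ (enum (children v)) wt transpoly C.
rewrite -sum_r big_enum size_r deg_le card_gt0 nlv andbT /= forall_desc andbA.
rewrite (_ : (_ == _) && _ = comb_node d v).
  apply=> // w; rewrite mem_enum childE => vw.
  by apply: IHn; apply: leq_trans (card_desc_child vw) _.
have -> : count (fun w => 0 < wt w)%N (enum (children v)) =
    #|children v :&: internal T|.
  rewrite -size_filter cardE; apply: perm_size; apply: uniq_perm.
  - exact/filter_uniq/enum_uniq.
  - exact: enum_uniq.
  - by move=> w; rewrite mem_filter !mem_enum card_desc_gt1 in_setI andbC.
have wt_eq0 : ((\sum_(w in children v) wt w)%N == 0%N) =
    (#|children v :&: internal T| == 0%N).
  rewrite sum_nat_eq0 cards_eq0 setI_eq0 disjoint_subset.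
  have wtP w : (wt w == 0%N) = (w \in [predC internal T]).
    by rewrite -[RHS]/(w \notin internal T) -card_desc_gt1 lt0n negbK.
  by apply/forall_inP/subsetP => H w /H; rewrite wtP.
have -> : #|desc v|.-1 = (#|children v| + \sum_(w in children v) wt w)%N.
  by rewrite sum_r big_enum /= -sum1_card -big_split.
(* With [m] children, [c] of them internal, and [a] proper descendants of
   children, the parent has [m + a] proper descendants.  If [c = 0], then
   [a = 0] and, as [m <= d], the number [m] is automatically [minn (m + a) d];
   if [c = 1], then [a > 0] and [m = minn (m + a) d] means [m = d]. *)
have := deg_le v; rewrite /comb_node; move: wt_eq0.
move: (\sum_(w in _) _)%N #|children v| #|children v :&: _| => a m c; lia.
Qed.

End Descendants.

(** * Full caterpillars and their uniqueness *)

Section Comb.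
Variables (T : rtree) (d : nat).
Implicit Types (u v w x : node T).

Lemma not_hits0 v : ~ hits v set0.
Proof.
have [n] := ubnP #|desc v|; elim: n v => // n IHn v lt_vn.
case/hits_rec => [|[/set0Pn[w vw] ch0]]; first by rewrite inE.
apply: IHn (ch0 w vw); rewrite childE in vw.
exact: leq_trans (card_desc_child vw) _.
Qed.

(** A tree has a path from the root to a leaf, so the empty set is no
    transversal. *)
Lemma ntransversals_gt0 k : 0 < ntransversals T k -> 1 <= k <= #|node T|.
Proof.
case/card_gt0P=> S; rewrite inE => /andP[/asboolP S_hits /eqP <-].
rewrite max_card andbT card_gt0; apply/negP => /eqP S0.
by apply: (@not_hits0 (root T)); rewrite -S0.
Qed.

Section Caterpillar.
Hypotheses (T_cat : full_caterpillar T d).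

Lemma desc_lowest_internal v : v \in internal T ->
  exists2 x, x \in desc v & x \in leaves_in (internal T).
Proof.
have [n] := ubnP #|desc v|; elim: n v => // n IHn v lt_vn v_int.
have [no_int|/set0Pn[w]] := eqVneq (children v :&: internal T) set0.
  by exists v; rewrite ?desc_refl // inE v_int no_int eqxx.
case/setIP=> vw w_int; rewrite childE in vw.
have [|x wx x_low] := IHn w _ w_int.
  exact: leq_trans (card_desc_child vw) _.
exists x => //; rewrite desc_children inE; apply/orP; right.
by apply/bigcupP; exists w; rewrite ?childE.
Qed.

Lemma full_caterpillar_deg v : #|children v| <= d.
Proof.
case: T_cat => _ deg_eq deg_le.
have [v_int|] := boolP (v \in internal T); last first.
  by rewrite internalE negbK => /eqP ->; rewrite cards0.
by have [/deg_le //|/(deg_eq v v_int) ->] :=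
  boolP (v \in leaves_in (internal T)).
Qed.

(** Two internal children of one node would have distinct lowest internal
    descendants, whereas a caterpillar has a single lowest internal node; a node
    with an internal child is not that one, so it has [d] children. *)
Lemma full_caterpillar_comb v : comb_node d v.
Proof.
case: T_cat => /eqP/cards1P[l low_l] deg_eq _.
apply/andP; split.
  rewrite leqNgt; apply/card_gt1P => -[u [w []]].
  move=> /setIP[vu u_int] /setIP[vw w_int].
  have [x ux] := desc_lowest_internal u_int.
  have [y wy] := desc_lowest_internal w_int.
  rewrite low_l => /set1P eq_y /set1P eq_x.
  rewrite eq_y in wy; rewrite eq_x in ux; rewrite !childE in vu vw.
  by rewrite (siblings_disjoint vu vw ux wy) eqxx.
apply/implyP => /cards1P[w ch_w].
have vw : w \in children v :&: internal T by rewrite ch_w set11.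
apply/eqP/deg_eq.
  by rewrite internalE; apply/set0Pn; exists w; case/setIP: vw.
by rewrite inE negb_and; apply/orP; right; apply/set0Pn; exists w.
Qed.

End Caterpillar.

Hypotheses (T_deg : forall v, #|children v| <= d)
  (T_comb : forall v, comb_node d v).

(** List [v], then its leaf children, then recursively the subtree at its
    internal child, if any.  An internal child forces [v] to have [d] children,
    so [v] and its leaf children fill the first [d] places, and the recursive
    numbering is shifted by exactly [d], which is compatible with the rule that
    the parent of node [j + 1] is node [j %/ d * d]. *)
Lemma comb_enum v : exists s, [/\ uniq (v :: s), v :: s =i desc v &
  forall x0 j, j < size s -> child (nth x0 (v :: s) (j %/ d * d)) (nth x0 s j)].
Proof.
have [n] := ubnP #|desc v|; elim: n v => // n IHn v lt_vn.
have desc_leaf x : x \notin internal T -> desc x = [set x].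
  by rewrite internalE negbK => /eqP ch0;
    rewrite desc_children ch0 big_set0 setU0.
have v_nch : v \notin children v.
  rewrite childE; apply/negP => vv.
  by have := child_acyclic vv; rewrite connect0.
have child_desc x : x \in children v -> x \in desc v.
  by rewrite !inE; apply: connect1.
have /andP[] := T_comb v; rewrite leq_eqVlt => /orP[|]; last first.
  rewrite ltnS leqn0 cards_eq0 => /eqP no_int _.
  have leaf_ch w : w \in children v -> w \notin internal T.
    by move=> vw; apply: contra_eqN no_int => w_int; apply/set0Pn; exists w;
      rewrite inE vw.
  exists (enum (children v)); split=> [||x0 j].
  - by rewrite /= mem_enum v_nch enum_uniq.
  - move=> x; rewrite inE mem_enum; apply/orP/idP => [[/eqP->|]|].
    + exact: desc_refl.
    + exact: child_desc.
    rewrite desc_children inE => /orP[/set1P-> |/bigcupP[w vw]];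
      first by rewrite eqxx; left.
    by rewrite (desc_leaf w (leaf_ch w vw)) => /set1P->; right.
  - rewrite -cardE => lt_j; rewrite divn_small ?(leq_trans lt_j) //=.
    by rewrite -childE -mem_enum mem_nth -?cardE.
move=> card1; rewrite card1 /= => /eqP deg_d; case/cards1P: card1 => w ch_w.
have /setIP[vw w_int] : w \in children v :&: internal T by rewrite ch_w set11.
have [|s [s_uniq s_desc s_child]] := IHn w.
  by rewrite childE in vw; apply: leq_trans (card_desc_child vw) _.
pose L := children v :\: internal T.
have d_L : d = #|L|.+1.
  by rewrite -deg_d -(cardsID (internal T) (children v)) ch_w cards1.
have L_leaf x : x \in L -> x \in children v /\ x \notin internal T.
  by case/setDP.
have size_L : size (v :: enum L) = d by rewrite /= -cardE.
exists (enum L ++ w :: s); split.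
- change (uniq ((v :: enum L) ++ w :: s)); rewrite cat_uniq s_uniq andbT.
  rewrite [uniq _]/= mem_enum enum_uniq andbT; apply/andP; split.
    by apply: contra v_nch => /L_leaf[].
  apply/hasPn => x; rewrite s_desc => wx /=; rewrite inE mem_enum negb_or.
  apply/andP; split.
    apply: contra (notin_desc_children v) => /eqP eq_xv.
    by apply/bigcupP; exists w; rewrite // -eq_xv.
  apply/negP => /L_leaf[vx x_leaf]; move: (x_leaf); rewrite !childE in vx vw.
  by rewrite (siblings_disjoint vx vw (desc_refl x) wx) w_int.
- move=> x; rewrite inE mem_cat s_desc mem_enum.
  apply/idP/idP => [/or3P[/eqP->|/L_leaf[vx _]|wx]|].
  + exact: desc_refl.
  + exact: child_desc.
  + by rewrite desc_children inE; apply/orP; right; apply/bigcupP; exists w.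
  rewrite desc_children inE => /orP[/set1P-> |/bigcupP[u vu ux]];
    first by rewrite eqxx.
  apply/or3P; have [u_int|u_leaf] := boolP (u \in internal T).
    have : u \in children v :&: internal T by rewrite inE vu.
    by rewrite ch_w => /set1P eq_uw; rewrite -eq_uw; apply: Or33.
  move: ux; rewrite desc_leaf // => /set1P ->; apply: Or32.
  by rewrite inE u_leaf.
- move=> x0 j lt_j.
  (* For [j < d] the node is a child of [v], the internal child [w] being
     reached at [j = d - 1]. *)
  have [lt_jd|le_dj] := ltnP j d.
    rewrite divn_small // mul0n /= -childE nth_cat -cardE.
    case: ltnP => [lt_jL|le_Lj].
      have : nth x0 (enum L) j \in L by rewrite -mem_enum mem_nth -?cardE.
      by case/L_leaf.
    by have -> : j - #|L| = 0 by lia.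
  rewrite -[X in child _ X]/(nth x0 (v :: enum L ++ w :: s) j.+1).
  rewrite -[v :: _ ++ _]/((v :: enum L) ++ w :: s) !nth_cat size_L !ltnNge.
  have le_par : d <= j %/ d * d.
    by rewrite -{1}[d]mul1n leq_mul2r divn_gt0 ?le_dj ?orbT // d_L.
  rewrite le_par (leqW le_dj) /=.
  have -> : j.+1 - d = (j - d).+1 by lia.
  have -> : j %/ d * d - d = (j - d) %/ d * d.
    by rewrite -{1}(subnK le_dj) divnDr ?dvdnn // divnn d_L /= mulnDl mul1n
      addnK.
  apply: s_child; move: lt_j; rewrite size_cat /= -cardE; lia.
Qed.

(** With unique parents and no duplicates, [comb_enum] determines the whole
    child relation. *)
Lemma comb_order : exists s : seq (node T), [/\ uniq s, s =i predT,
  nth (root T) s 0 = root T &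
  forall i j, i < size s -> j < size s ->
    child (nth (root T) s i) (nth (root T) s j) =
    (0 < j) && (i == j.-1 %/ d * d)].
Proof.
have [s [s_uniq s_desc s_child]] := comb_enum (root T).
exists (root T :: s); split=> // [x|i [|j] lt_i lt_j].
- by rewrite s_desc desc_root inE.
- by rewrite /= (negPf (root_orphan _)).
have par_j := s_child (root T) j lt_j.
have lt_par : j %/ d * d < size (root T :: s).
  by apply: leq_ltn_trans (leq_trunc_div j d) (ltnW lt_j).
rewrite -(nth_uniq (root T) lt_i lt_par s_uniq).
apply/idP/eqP => [ij|->//].
exact: parent_uniq ij par_j.
Qed.

End Comb.

Lemma comb_isomorphic (T T' : rtree) d : #|node T| = #|node T'| ->
  (forall v : T, #|children v| <= d) -> (forall v : T, comb_node d v) ->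
  (forall v : T', #|children v| <= d) -> (forall v : T', comb_node d v) ->
  isomorphic T T'.
Proof.
move=> card_T T_deg T_comb T'_deg T'_comb.
have [s [s_uniq s_all s_root s_child]] := comb_order T_deg T_comb.
have [s' [s'_uniq s'_all s'_root s'_child]] := comb_order T'_deg T'_comb.
have size_s : size s = size s'.
  by rewrite -(card_uniqP s_uniq) -(card_uniqP s'_uniq) (eq_card s_all)
    (eq_card s'_all).
have ltT u : index u s < size s by rewrite index_mem s_all.
have ltT' u : index u s' < size s' by rewrite index_mem s'_all.
exists (fun u => nth (root T') s' (index u s)); split.
- exists (fun u => nth (root T) s (index u s')) => u.
    by rewrite index_uniq -?size_s // nth_index ?s_all.
  by rewrite index_uniq ?size_s // nth_index ?s'_all.
- by rewrite -{1}s_root index_uniq // (leq_ltn_trans _ (ltT (root T))).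
- move=> u v; rewrite s'_child -?size_s // -(s_child _ _ (ltT u) (ltT v)).
  by rewrite !nth_index ?s_all.
Qed.

Theorem theorem2 (n d : nat) (d_gt0 : 0 < d) (d_lt_n : d < n)
  (Tstar : rtree) (Tstar_size : #|node Tstar| = n)
  (Tstar_full : full_caterpillar Tstar d)
  (T : rtree) (T_size : #|node T| = n)
  (T_deg : forall v : node T, v \in internal T -> #|children v| <= d) :
  dominates T Tstar \/ isomorphic T Tstar.
Proof.
have deg_star := full_caterpillar_deg Tstar_full.
have comb_star := full_caterpillar_comb Tstar_full.
have deg_T (v : T) : #|children v| <= d.
  have [/T_deg//|] := boolP (v \in internal T).
  by rewrite internalE negbK => /eqP ->; rewrite cards0.
have := transpoly_leif (root Tstar) d_gt0 deg_star.
have := transpoly_leif (root T) d_gt0 deg_T.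
rewrite !desc_root !cardsT T_size Tstar_size.
have -> : [forall u in [set: Tstar], comb_node d u] by apply/forall_inP.
set C := [forall u in _, _] => leT /coef_leif_eq eq_star.
rewrite eq_star in leT.
have [/forall_inP combT|notC] := boolP C.
  right; apply: comb_isomorphic deg_T _ deg_star comb_star;
    first by rewrite T_size.
  by move=> v; apply: combT; rewrite inE.
left; rewrite (negPf notC) in leT; split=> [|k _|].
- by rewrite T_size.
- by rewrite !ntransversalsE; apply: leT.1.
have [k lt_k] := coef_leif_false_lt leT.
have lt_ntr : ntransversals Tstar k < ntransversals T k.
  by rewrite !ntransversalsE.
by exists k => //; apply: ntransversals_gt0; apply: leq_ltn_trans lt_ntr.
Qed.
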